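(* For every integer $k\ge 3$ there exists a $2$-edge-connected plane graph $G$ with exactly $4k$ edges such that $\chi_{fp}'(G)=12$.
   Context: All graphs are finite, planar, with a fixed plane embedding. An edge-coloring of a plane graph $G$ is a map $E(G)\to\mathbb{N}$. It is facially-proper if for every face $\alpha$, any two edges that appear consecutively on the boundary walk of $\alpha$ receive distinct colors. A facial-parity edge-coloring of a $2$-edge-connected plane graph $G$ is a facially-proper edge-coloring such that for every face $\alpha$ and every color $c$, the number of edges incident with $\alpha$ having color $c$ is either zero or odd. $\chi_{fp}'(G)$ denotes the minimum number of colors in a facial-parity edge-coloring of $G$. *)

(* Defs.v *)
From HB Require Import structures.
From mathcomp Require Import all_boot all_fingroup.

Set Implicit Arguments.
Unset Strict Implicit.
Unset Printing Implicit Defensive.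

Record sgraph := SGraph {
  vertex :> finType;
  adj : rel vertex;
  adj_sym : symmetric adj;
  adj_irr : irreflexive adj
}.

(* A dart is an edge together with one of its two orientations. *)
Definition dart (G : sgraph) : finType := {p : G * G | adj p.1 p.2}.

Definition tail (G : sgraph) (d : dart G) : G := (val d).1.
Definition head (G : sgraph) (d : dart G) : G := (val d).2.

Lemma rev_subproof (G : sgraph) (d : dart G) :
  adj ((head d, tail d) : G * G).1 ((head d, tail d) : G * G).2.
Proof. by rewrite /= adj_sym; exact: (valP d). Qed.

Definition rev (G : sgraph) (d : dart G) : dart G :=
  Sub (head d, tail d) (rev_subproof d).

Lemma revK (G : sgraph) : involutive (@rev G).
Proof. by move=> d; apply: val_inj; rewrite /rev /head /tail !SubK; case: (val d). Qed.

Definition rev_perm (G : sgraph) : {perm dart G} := perm (inv_inj (@revK G)).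

Definition edge_of (G : sgraph) (d : dart G) : {set G} := [set tail d; head d].
Definition edges (G : sgraph) : {set {set G}} := [set edge_of d | d : dart G].

Definition connected (T : finType) (r : rel T) : Prop :=
  forall x y : T, connect r x y.

(* The relation [[set x; y] != e] deletes the edge e, keeping its ends. *)
Definition two_edge_connected (G : sgraph) : Prop :=
  [/\ 1 < #|G|, connected (@adj G) &
      forall e : {set G}, e \in edges G ->
        connected [rel x y : G | adj x y && ([set x; y] != e)]].

(* For a rotation rot, which turns each dart into the next one around its    *)
(* tail, the boundary walk of the face on one side of a dart d leaves the    *)
(* head of d along rot (rev d).                                              *)
Definition walk_perm (G : sgraph) (rot : {perm dart G}) : {perm dart G} :=
  (rev_perm G * rot)%g.

(* An embedding of a connected graph in the plane, up to homeomorphism and   *)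
(* the choice of the outer face (on which facial parity does not depend), is *)
(* a cyclic order of the darts leaving each vertex such that Euler's formula *)
(* V - E + F = 2 holds. Connectivity is required so that each face has a     *)
(* single boundary walk, i.e., faces are the cycles of walk_perm.            *)
Record plane_graph := PlaneGraph {
  graph :> sgraph;
  rot : {perm dart graph};
  rotP : forall d d' : dart graph, (d' \in porbit rot d) = (tail d' == tail d);
  plane_connected : connected (@adj graph);
  plane_euler : #|graph| + #|porbits (walk_perm rot)| = #|edges graph| + 2
}.

Definition walk_next (G : plane_graph) : {perm dart G} := walk_perm (rot G).

Definition faces (G : plane_graph) : {set {set dart G}} := porbits (walk_next G).

Definition face_edges (G : plane_graph) (f : {set dart G}) : {set {set G}} :=
  [set edge_of d | d in f].

(* An edge-coloring is given by a total function on vertex sets, of which    *)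
(* only the values on edges G are ever used.                                 *)
Definition facially_proper (G : plane_graph) (c : {set G} -> nat) : Prop :=
  forall f : {set dart G}, f \in faces G ->
    forall d : dart G, d \in f -> c (edge_of d) <> c (edge_of (walk_next G d)).

Definition facial_parity (G : plane_graph) (c : {set G} -> nat) : Prop :=
  facially_proper c /\
  forall (f : {set dart G}) (a : nat), f \in faces G ->
    let m := #|[set e in face_edges f | c e == a]| in m = 0 \/ odd m.

Definition num_colors (G : plane_graph) (c : {set G} -> nat) : nat :=
  size (undup [seq c e | e in edges G]).

Definition is_facial_parity_index (G : plane_graph) (n : nat) : Prop :=
  (exists2 c : {set G} -> nat, facial_parity c & num_colors c = n) /\
  (forall c : {set G} -> nat, facial_parity c -> n <= num_colors c).

(* Main.v *)
Require Import Defs.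
From HB Require Import structures.
From mathcomp Require Import all_boot all_fingroup zify.
(* Gives Defs.rev, Defs.head and Defs.rot precedence over their namesakes on sequences. *)
Import Defs.

Set Implicit Arguments.
Unset Strict Implicit.
Unset Printing Implicit Defensive.

(* The witness is a theta graph: three internally disjoint paths, of lengths  *)
(* 4, 4 and 4 (k - 2), joining two vertices. Each of its three faces is       *)
(* bounded by two of the paths. If x0, x1, x2 are the multiplicities of a     *)
(* color on the three paths, then each of the sums of two of them is zero or  *)
(* odd; their total is even, so not all are odd, and the color occurs on at   *)
(* most one path, an odd number of times. A path of length 4 l thus carries   *)
(* an even number of colors; with only two, properness would make them        *)
(* alternate and each would occur 2 l times. So each path needs four colors   *)
(* of its own, which is also enough: color a path a b c d a b a b ... a b.    *)

(** Besides the parity argument above, one has to realize the theta graph as a two-edge-connected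
    plane graph. The embedding is combinatorial: a dart is a numbered edge with a direction, the
    face walk is prescribed directly, and the rotation is read off from it ([list_rot],
    [list_rotP]). A label invariant under the walk separates three representative darts, so there
    are exactly three faces, and Euler's formula holds because the graph has one vertex fewer than
    edges. No edge is a bridge, since its two darts lie on different faces
    ([two_edge_connected_walk]).

    [face_color_count] expresses how often a color occurs on a face as a sum over two paths. The
    lower bound combines [color_one_path] (distinct paths share no color, and each color on a path
    is there an odd number of times) with [four_colors_path] (each path then needs four colors);
    [theta_coloring] attains 12. *)

Lemma set2_eq (T : finType) (a b c d : T) :
  a != b -> [set a; b] = [set c; d] -> (a, b) = (c, d) \/ (a, b) = (d, c).
Proof.
move=> ab abE.
have : a \in [set c; d] by rewrite -abE !inE eqxx.
have : b \in [set c; d] by rewrite -abE !inE eqxx orbT.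
rewrite !inE; move: ab.
by move=> /[swap] /orP[] /eqP -> /[swap] /orP[] /eqP ->; rewrite ?eqxx //; [right|left].
Qed.

Lemma edge_of_eq (G : sgraph) (x y : dart G) :
  edge_of x = edge_of y -> x = y \/ x = rev y.
Proof.
have x_neq : tail x != head x.
  by apply: contraTneq (valP x) => xE; rewrite -/(tail x) -/(head x) xE adj_irr.
move=> /(set2_eq x_neq)[] xE; [left|right]; apply: val_inj; rewrite ?SubK -?xE //.
- by rewrite [LHS]surjective_pairing xE -surjective_pairing.
- by rewrite -surjective_pairing.
Qed.

(** * Simple graphs from edge lists, with a prescribed face walk *)

Section EdgeList.

Variables (V E : finType) (src tgt : E -> V).

Definition tl (d : E * bool) : V := if d.2 then src d.1 else tgt d.1.
Definition flip (d : E * bool) : E * bool := (d.1, ~~ d.2).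
Definition hd (d : E * bool) : V := tl (flip d).

(** Since both directions of each edge count, this excludes parallel edges and also loops: a loop
    would give [d] and [flip d] the same ends. *)
Hypothesis simple : injective (fun d => (tl d, hd d)).

Lemma flipK : involutive flip.
Proof. by case=> e b; rewrite /flip /= negbK. Qed.

Lemma hd_flip d : hd (flip d) = tl d.
Proof. by rewrite /hd flipK. Qed.

Definition list_adj : rel V := [rel u v | [exists d, (tl d, hd d) == (u, v)]].

Lemma list_adj_sym : symmetric list_adj.
Proof.
by move=> u v; apply/existsP/existsP => -[d /eqP[<- <-]]; exists (flip d);
  rewrite hd_flip.
Qed.

Lemma list_adj_irr : irreflexive list_adj.
Proof.
move=> u; apply/existsP => -[d /eqP[tu hu]].
have /simple : (tl (flip d), hd (flip d)) = (tl d, hd d).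
  by rewrite hd_flip -/(hd d) tu hu.
by case: d {tu hu} => e [].
Qed.

Definition list_graph := SGraph list_adj_sym list_adj_irr.
Local Notation G := list_graph.

Lemma mkdart_subproof d : @adj G (tl d, hd d).1 (tl d, hd d).2.
Proof. by apply/existsP; exists d. Qed.

Definition mkdart (d : E * bool) : dart G := Sub (tl d, hd d) (mkdart_subproof d).

Lemma mkdart_inj : injective mkdart.
Proof. by move=> d d' /(congr1 val); rewrite !SubK => /simple. Qed.

Lemma mkdart_surj (x : dart G) : exists d, mkdart d == x.
Proof.
have /existsP[d /eqP dE] := valP x.
by exists d; apply/eqP/val_inj; rewrite SubK dE -surjective_pairing.
Qed.

Definition undart (x : dart G) := xchoose (mkdart_surj x).

Lemma undartK : cancel undart mkdart.
Proof. by move=> x; apply/eqP/(xchooseP (mkdart_surj x)). Qed.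

Lemma mkdartK : cancel mkdart undart.
Proof. by move=> d; apply: mkdart_inj; rewrite undartK. Qed.

Lemma tail_mkdart d : tail (mkdart d) = tl d.
Proof. by rewrite /tail SubK. Qed.

Lemma head_mkdart d : head (mkdart d) = hd d.
Proof. by rewrite /head SubK. Qed.

Lemma rev_mkdart d : rev (mkdart d) = mkdart (flip d).
Proof.
by apply: val_inj; rewrite !SubK head_mkdart tail_mkdart hd_flip.
Qed.

Definition edge (e : E) : {set G} := [set src e; tgt e].

Lemma edge_of_mkdart d : edge_of (mkdart d) = edge d.1.
Proof.
rewrite /edge_of tail_mkdart head_mkdart /hd /tl /edge /=.
by case: d.2; rewrite //= setUC.
Qed.

Lemma edge_inj : injective edge.
Proof.
move=> e e'; rewrite -(edge_of_mkdart (e, true)) -(edge_of_mkdart (e', true)).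
by move=> /edge_of_eq[]; rewrite ?rev_mkdart => /mkdart_inj[].
Qed.

Lemma edges_list : edges G = [set edge e | e : E].
Proof.
apply/setP => S; apply/imsetP/imsetP => [[x _ ->]|[e _ ->]].
  by exists (undart x).1; rewrite // -[x in LHS]undartK edge_of_mkdart.
by exists (mkdart (e, true)); rewrite // edge_of_mkdart.
Qed.

Lemma card_edges_list : #|edges G| = #|E|.
Proof. by rewrite edges_list card_imset //; exact: edge_inj. Qed.

Section Walk.

Variable w : E * bool -> E * bool.
Hypothesis w_inj : injective w.

Definition dart_walk (x : dart G) : dart G := mkdart (w (undart x)).

Lemma dart_walk_inj : injective dart_walk.
Proof. by move=> x y /mkdart_inj/w_inj/(can_inj undartK). Qed.

(** The face walk is reversal followed by the rotation, and reversal is an involution, so this is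
    the one rotation whose face walk is [w]. *)
Definition list_rot : {perm dart G} := (rev_perm G * perm dart_walk_inj)%g.

Lemma walk_permE d : walk_perm list_rot (mkdart d) = mkdart (w d).
Proof. by rewrite /walk_perm !permM !permE revK /dart_walk mkdartK. Qed.

Lemma list_rotE d : list_rot (mkdart d) = mkdart (w (flip d)).
Proof. by rewrite /list_rot permM !permE rev_mkdart /dart_walk mkdartK. Qed.

Lemma porbit_next (T : finType) (s : {perm T}) x y :
  y \in porbit s x -> s y \in porbit s x.
Proof. by move=> /porbitP[i ->]; rewrite -permM -expgSr mem_porbit. Qed.

Lemma porbit_invariant (T : finType) (R : eqType) (s : {perm T}) (g : T -> R) x y :
  (forall z, g (s z) = g z) -> y \in porbit s x -> g y = g x.
Proof.
move=> gs /porbitP[i ->]; elim: i => [|i IHi]; first by rewrite expg0 perm1.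
by rewrite expgSr permM gs.
Qed.

(** [w (flip d)] is the next dart around the tail of [d]. Three alternatives suit maximum degree 3,
    where two rotation steps exhaust the darts at a vertex. *)
Lemma list_rotP :
  (forall d, tl (w d) = hd d) ->
  (forall d d', tl d = tl d' ->
     [\/ d' = d, d' = w (flip d) | d' = w (flip (w (flip d)))]) ->
  forall x y : dart G, (y \in porbit list_rot x) = (tail y == tail x).
Proof.
move=> tlw tl_eq x y; apply/idP/eqP.
  apply: (@porbit_invariant _ _ _ (@tail G)) => z.
  by rewrite -[z]undartK list_rotE !tail_mkdart tlw hd_flip.
rewrite -[x]undartK -[y]undartK !tail_mkdart => /esym/tl_eq[] ->.
- exact: porbit_id.
- by rewrite -list_rotE porbit_next // porbit_id.
- by rewrite -!list_rotE !porbit_next // porbit_id.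
Qed.

End Walk.

End EdgeList.

(** * Bridgelessness from the faces *)

(** If the two darts of an edge lie on different face walks, the rest of the walk through one of
    them leads from its head back to its tail and avoids the edge. Any path using the edge can be
    rerouted along it. *)
Lemma two_edge_connected_walk (G : plane_graph) :
  1 < #|G| ->
  (forall d : dart G, rev d \notin porbit (walk_next G) d) ->
  two_edge_connected G.
Proof.
move=> G1 revG; split=> //; first exact: plane_connected.
move=> _ /imsetP[d _ ->]; set r := [rel x y : G | _].
have r_sym : symmetric r by move=> x y; rewrite /r /= adj_sym setUC.
have tail_walk x : tail (walk_next G x) = head x.
  have : walk_next G x \in porbit (rot G) (rev x).
    by rewrite /walk_next /walk_perm permM permE porbit_next ?porbit_id.
  by rewrite rotP => /eqP ->; rewrite /rev /tail SubK.
have r_dart x : x != d -> x != rev d -> r (tail x) (head x).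
  move=> xd xrd; rewrite /r /= (valP x) /=.
  apply/eqP; rewrite -[[set _; _]]/(edge_of x) => /edge_of_eq[] xE.
    by rewrite xE eqxx in xd.
  by rewrite xE eqxx in xrd.
set w := walk_next G.
have walk_path i : i < #|porbit w d| -> connect r (head d) (tail ((w ^+ i.+1)%g d)).
  elim: i => [_|i IHi i_lt]; first by rewrite expg1 tail_walk.
  apply: connect_trans (IHi (ltnW i_lt)) _.
  rewrite [in X in connect _ _ X]expgSr permM tail_walk; apply/connect1/r_dart.
    (* The walk meets [d] again only when its orbit closes up, because one period of it has no
       repetition. *)
    have := uniq_traject_porbit w d.
    rewrite -{1}(prednK (ltn_trans (ltn0Sn i) i_lt)) /= => /andP[+ _].
    apply: contraNneq => dE; rewrite -[X in X \in _]dE; apply/trajectP; exists i.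
      by rewrite -ltnS (prednK (ltn_trans (ltn0Sn i) i_lt)).
    by rewrite -iterSr -permX.
  by apply: contraNneq (revG d) => <-; exact: mem_porbit.
have hd_tl : connect r (head d) (tail d).
  have o_gt0 : 0 < #|porbit w d| by apply/card_gt0P; exists d; exact: porbit_id.
  have := walk_path #|porbit w d|.-1; rewrite prednK // => /(_ (leqnn _)).
  by rewrite permX iter_porbit.
move=> x y; have /connectP[p xp ->] := plane_connected x y.
elim: p x xp => [|z p IHp] x /=; first by rewrite connect0.
move=> /andP[xz /IHp]; apply: connect_trans.
pose e : dart G := Sub (x, z) xz.
have [|ed] := eqVneq e d.
  move=> /(congr1 val); rewrite SubK => dE.
  rewrite (sym_connect_sym r_sym).
  by move: hd_tl; rewrite /head /tail -dE.
have [|erd] := eqVneq e (rev d).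
  by move=> /(congr1 val); rewrite !SubK => -[-> ->].
by have := r_dart e ed erd; rewrite /tail /head SubK => re; exact: connect1.
Qed.

(** * Orbit counting and colors along a path *)

Lemma card_porbits_reps (T : finType) (R : eqType) (s : {perm T}) (g : T -> R) (r : seq T) :
  (forall x, g (s x) = g x) -> uniq r -> {in r &, injective g} ->
  (forall x, exists2 y, y \in r & x \in porbit s y) -> #|porbits s| = size r.
Proof.
move=> gs uniq_r g_inj repr.
have -> : porbits s = [set porbit s y | y in r].
  apply/setP => f; apply/imsetP/imsetP => [[x _ ->]|[y _ ->]]; last by exists y.
  have [y yr xy] := repr x; exists y => //.
  by apply/eqP; rewrite eq_porbit_mem.
rewrite card_in_imset ?(card_uniqP uniq_r) // => x y xr yr /eqP.
by rewrite eq_porbit_mem => /(porbit_invariant gs); apply: g_inj.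
Qed.

(** The length is the sum of the multiplicities of the distinct values, and every summand is odd. *)
Lemma odd_size_undup (T : eqType) (s : seq T) :
  (forall a, a \in s -> odd (count_mem a s)) -> odd (size s) = odd (size (undup s)).
Proof.
move=> odd_s; rewrite -(perm_size (perm_count_undup s)) size_flatten /shape -map_comp.
have : {subset undup s <= s} by move=> a; rewrite mem_undup.
elim: (undup s) => //= a u IHu sub_u; rewrite oddD size_nseq odd_s ?sub_u ?mem_head //.
by rewrite IHu // => b bu; rewrite sub_u // inE bu orbT.
Qed.

(** Peel off two entries at a time: being distinct and among [a], [b], they contain [a] exactly
    once. *)
Lemma count_alternating (T : eqType) (a b : T) (s : seq T) :
  a != b -> sorted (fun x y => x != y) s -> {subset s <= [:: a; b]} -> ~~ odd (size s) ->
  (count_mem a s).*2 = size s.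
Proof.
move=> ab; have [n] := ubnP (size s); elim: n s => // n IHn [|x [|y s]] //=.
rewrite ltnS negbK => s_lt /andP[xy /path_sorted s_sorted] sub_s s_even.
have /[!inE] x_ab : x \in [:: a; b] by rewrite sub_s ?mem_head.
have /[!inE] y_ab : y \in [:: a; b] by rewrite sub_s // !inE eqxx orbT.
have s_half : (count_mem a s).*2 = size s.
  apply: IHn => //; first by lia.
  by move=> z zs; rewrite sub_s // !inE zs !orbT.
suff : (x == a) + (y == a) = 1 by lia.
move: x_ab y_ab xy ab.
by move=> /orP[] /eqP -> /orP[] /eqP ->; rewrite ?eqxx // ?(eq_sym b a); case: eqP.
Qed.

(** Divisibility by 4 is used twice: the number of distinct values is even, and with just two values
    each would fill half the length, again an even number. *)
Lemma four_colors_path (T : eqType) (s : seq T) :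
  0 < size s -> 4 %| size s -> sorted (fun x y => x != y) s ->
  (forall a, a \in s -> odd (count_mem a s)) -> 4 <= size (undup s).
Proof.
move=> s_gt0 s4 s_sorted odd_s; have := odd_size_undup odd_s.
have : size (undup s) != 0 by rewrite size_eq0; apply: contraTneq s_gt0 => /undup_nil ->.
suff : size (undup s) != 2 by lia.
apply/eqP => size2; move: (undup_uniq s) (mem_undup s) size2.
case: (undup s) => [|a [|b []]] //=; rewrite inE andbT => ab mem_s _.
have := odd_s a; rewrite -mem_s mem_head => /(_ isT).
have : (count_mem a s).*2 = size s.
  apply: (count_alternating ab) => // [x|]; first by rewrite mem_s.
  by lia.
by lia.
Qed.
Arguments tl : simpl never.
Arguments hd : simpl never.

Ltac split_ifs := repeat match goal with |- context [if ?x == ?y then _ else _] =>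
  lazymatch x with context [if _ then _ else _] => fail | _ => case: (x =P y) => ? /= end
  end.

(** * Incidences and face walk of the theta graph *)

Section Theta.

Variable q : nat.

(** For [q = k - 3] there are [m.+2 = 4 * k] edges, the third path having [4 * (k - 2)] of them, and
    [m.+1] vertices. *)
Local Notation m := (4 * q + 10).

(* Paths are edges 0..3, 4..7 and 8..m+1, each oriented from vertex 7 to       *)
(* vertex 3; any other vertex bears the number of the edge entering it.       *)
Definition src_nat (e : nat) : nat :=
  if e == 0 then 7 else if e == 4 then 7 else if e == 8 then 7 else e.-1.

Definition tgt_nat (e : nat) : nat :=
  if e == 3 then 3 else if e == 7 then 3 else if e == m.+1 then 3 else e.

(** Each face runs forward along one path and backward along the cyclically next one; the
    exceptional cases are the turns at vertices 3 and 7. *)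
Definition walk_nat (e : nat) (b : bool) : nat * bool :=
  if b then
    if e == 3 then (7, false) else if e == 7 then (m.+1, false)
    else if e == m.+1 then (3, false) else (e.+1, true)
  else
    if e == 0 then (8, true) else if e == 4 then (0, true)
    else if e == 8 then (4, true) else (e.-1, false).

Definition theta_src (e : 'I_m.+2) : 'I_m.+1 := inord (src_nat e).
Definition theta_tgt (e : 'I_m.+2) : 'I_m.+1 := inord (tgt_nat e).

Definition theta_step (d : 'I_m.+2 * bool) : 'I_m.+2 * bool :=
  (inord (walk_nat d.1 d.2).1, (walk_nat d.1 d.2).2).

Local Notation ttl := (tl theta_src theta_tgt).
Local Notation thd := (hd theta_src theta_tgt).

Lemma val_src e : theta_src e = src_nat e :> nat.
Proof.
rewrite inordK // /src_nat; have := ltn_ord e.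
by split_ifs; lia.
Qed.

Lemma val_tgt e : theta_tgt e = tgt_nat e :> nat.
Proof.
rewrite inordK // /tgt_nat; have := ltn_ord e.
by split_ifs; lia.
Qed.

Arguments theta_step : simpl never.

Lemma val_step d : (theta_step d).1 = (walk_nat d.1 d.2).1 :> nat.
Proof.
case: d => e b; rewrite inordK // /walk_nat /=; have := ltn_ord e.
by case: b; split_ifs; lia.
Qed.

Lemma step_dir d : (theta_step d).2 = (walk_nat d.1 d.2).2.
Proof. by []. Qed.

Lemma dart_eq (d d' : 'I_m.+2 * bool) : d.1 = d'.1 :> nat -> d.2 = d'.2 -> d = d'.
Proof. by case: d d' => [e b] [e' b'] /= /val_inj -> ->. Qed.

Lemma val_tl e b : ttl (e, b) = (if b then src_nat e else tgt_nat e) :> nat.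
Proof. by rewrite /tl /=; case: b; rewrite ?val_src ?val_tgt. Qed.

Lemma val_hd e b : thd (e, b) = (if b then tgt_nat e else src_nat e) :> nat.
Proof. by rewrite /hd /flip val_tl; case: b. Qed.

Lemma ends_nat_inj (e e' : nat) (b b' : bool) : e < m.+2 -> e' < m.+2 ->
  (if b then src_nat e else tgt_nat e) = (if b' then src_nat e' else tgt_nat e') ->
  (if b then tgt_nat e else src_nat e) = (if b' then tgt_nat e' else src_nat e') ->
  (e == e') && (b == b').
Proof.
move=> em em'; rewrite /src_nat /tgt_nat.
by case: b; case: b'; repeat case: ifP => ?; lia.
Qed.

Lemma theta_simple : injective (fun d => (ttl d, thd d)).
Proof.
move=> [e b] [e' b'] [] /(congr1 val) + /(congr1 val).
rewrite /= !val_hd !val_tl => /ends_nat_inj/[apply].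
by move=> /(_ (ltn_ord e) (ltn_ord e'))/andP[/eqP eE /eqP bE]; apply: dart_eq.
Qed.

Lemma walk_nat_inj (e e' : nat) (b b' : bool) : e < m.+2 -> e' < m.+2 ->
  (walk_nat e b).2 = (walk_nat e' b').2 -> (walk_nat e b).1 = (walk_nat e' b').1 ->
  (e == e') && (b == b').
Proof.
move=> em em'; rewrite /walk_nat.
by case: b; case: b'; split_ifs; lia.
Qed.

Lemma theta_step_inj : injective theta_step.
Proof.
move=> [e b] [e' b'] dE.
have bE : (walk_nat e b).2 = (walk_nat e' b').2 := congr1 snd dE.
have := val_step (e, b); rewrite dE val_step => /esym.
move/(walk_nat_inj (ltn_ord e) (ltn_ord e') bE).
by case/andP => /eqP eE /eqP bE'; apply: dart_eq.
Qed.

Lemma tl_step d : ttl (theta_step d) = thd d.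
Proof.
case: d => e b; apply: val_inj; rewrite /= val_hd.
have := val_step (e, b); have : (theta_step (e, b)).2 = (walk_nat e b).2 by [].
case: (theta_step _) => f c /= -> fE; rewrite val_tl fE.
have := ltn_ord e; rewrite /walk_nat /src_nat /tgt_nat.
by case: b {fE}; split_ifs; lia.
Qed.

Lemma rotation_nat (e e' : nat) (b b' : bool) : e < m.+2 -> e' < m.+2 ->
  (if b then src_nat e else tgt_nat e) = (if b' then src_nat e' else tgt_nat e') ->
  let d1 := walk_nat e (~~ b) in let d2 := walk_nat d1.1 (~~ d1.2) in
  [|| (e' == e) && (b' == b), (e' == d1.1) && (b' == d1.2) | (e' == d2.1) && (b' == d2.2)].
Proof.
move=> em em'; rewrite /walk_nat /src_nat /tgt_nat.
by case: b; case: b'; split_ifs; lia.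
Qed.

Lemma tl_rotation d d' : ttl d = ttl d' ->
  [\/ d' = d, d' = theta_step (flip d) | d' = theta_step (flip (theta_step (flip d)))].
Proof.
case: d d' => [e b] [e' b'] /(congr1 val); rewrite /= !val_tl.
move=> /rotation_nat => /(_ (ltn_ord e) (ltn_ord e')) /or3P[] /andP[/eqP eE /eqP bE].
- by apply: Or31; apply: dart_eq.
- by apply: Or32; apply: dart_eq; rewrite ?val_step.
- apply: Or33; apply: dart_eq.
    by rewrite eE (val_step (flip _)) -(val_step (flip (e, b))).
  by rewrite bE step_dir -(val_step (flip (e, b))).
Qed.

End Theta.

(** * Faces, connectedness and Euler's formula *)

Section ThetaPlane.

Variable q : nat.

Local Notation m := (4 * q + 10).

Definition theta_graph : sgraph := list_graph (@theta_simple q).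
Definition theta_rot : {perm dart theta_graph} :=
  list_rot (@theta_simple q) (@theta_step_inj q).

Local Notation mk := (mkdart (@theta_simple q)).
Local Notation un := (undart (simple := @theta_simple q)).
Local Notation W := (walk_perm theta_rot).

Definition path_of (e : nat) : nat := if e < 4 then 0 else if e < 8 then 1 else 2.

(* A face is labelled by the only path not on its boundary. *)
Definition missed_path (d : 'I_m.+2 * bool) : nat :=
  (path_of d.1 + (if d.2 then 2 else 1)) %% 3.

Lemma missed_path_step d : missed_path (theta_step d) = missed_path d.
Proof.
case: d => e b; rewrite /missed_path val_step step_dir /walk_nat /path_of /=.
have := ltn_ord e.
by case: b; split_ifs; repeat case: ltnP => ? //=; lia.
Qed.

(** Each face traverses exactly one path forward, so the first forward darts of the three paths
    represent the faces. *)
Definition first_darts : seq (dart theta_graph) :=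
  [seq mk (inord e, true) | e <- [:: 0; 4; 8]].

Lemma face_repr x : exists2 y, y \in first_darts & x \in porbit W y.
Proof.
rewrite -[x](undartK); case: (undart x) => e b {x}.
have next (f : nat) c (g : nat) c' : g < m.+2 -> walk_nat q g c' = (f, c) ->
    (exists2 y, y \in first_darts & mk (inord g, c') \in porbit W y) ->
    exists2 y, y \in first_darts & mk (inord f, c) \in porbit W y.
  move=> gm wE [y yr gy]; exists y => //.
  have -> : (inord f, c) = theta_step (inord g : 'I_m.+2, c').
    by rewrite /theta_step /= inordK // wE.
  by have := porbit_next gy; rewrite walk_permE.
have fwd f : f < m.+2 -> exists2 y, y \in first_darts & mk (inord f, true) \in porbit W y.
  elim/ltn_ind: f => f IHf fm.
  have [first|not_first] := boolP (f \in [:: 0; 4; 8]).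
    exists (mk (inord f, true)); last exact: porbit_id.
    exact: (map_f (fun e => mk (inord e, true)) first).
  move: not_first; rewrite !inE !negb_or => /and3P[f0 f4 f8].
  apply: (next _ _ f.-1 true); [lia| |by apply: IHf; lia].
  by rewrite /walk_nat; split_ifs; try (exfalso; lia); congr pair; lia.
case: b; first by rewrite -[e]inord_val; apply: fwd.
rewrite -[e]inord_val; have := ltn_ord e; move: (val e) => {}e.
(* A backward dart is preceded by that of the next higher edge, hence induction on [m.+2 - e]; on
   the last edge of a path it is preceded by the last forward dart of another path. *)
have [n] := ubnP (m.+2 - e); elim: n e => // n IHn e en em.
have [->|e3] := eqVneq e 3.
  by apply: (next _ _ m.+1 true); [lia|rewrite /walk_nat; split_ifs => //; lia|apply: fwd; lia].
have [->|e7] := eqVneq e 7; first by apply: (next _ _ 3 true); [lia| |apply: fwd; lia].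
have [->|em1] := eqVneq e m.+1; first by apply: (next _ _ 7 true); [lia| |apply: fwd; lia].
apply: (next _ _ e.+1 false); [lia| |by apply: IHn; lia].
by rewrite /walk_nat; split_ifs; try (exfalso; lia).
Qed.

Lemma missed_path_walk x : missed_path (un (W x)) = missed_path (un x).
Proof.
by rewrite -[x](undartK (simple := @theta_simple q)) walk_permE !mkdartK missed_path_step.
Qed.

Lemma missed_path_first :
  [seq missed_path (un x) | x <- first_darts] = [:: 2; 0; 1].
Proof.
rewrite -map_comp /= !mkdartK /missed_path /= !inordK //; lia.
Qed.

Lemma first_darts_inj : {in first_darts &, injective (missed_path \o un)}.
Proof.
move=> x y /(nthP x)[i i_lt <-] /(nthP x)[j j_lt <-] /eqP.
have u : uniq (map (missed_path \o un) first_darts) by rewrite missed_path_first.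
by rewrite -!(nth_map _ 0) ?nth_uniq ?size_map // => /eqP ->.
Qed.

Lemma uniq_first_darts : uniq first_darts.
Proof. by apply: (@map_uniq _ _ (missed_path \o un)); rewrite missed_path_first. Qed.

Lemma porbit_missed_path x y :
  (y \in porbit W x) = (missed_path (un y) == missed_path (un x)).
Proof.
apply/idP/eqP; first exact: (porbit_invariant missed_path_walk).
have [x' x'r xx'] := face_repr x; have [y' y'r yy'] := face_repr y.
rewrite (porbit_invariant missed_path_walk xx') (porbit_invariant missed_path_walk yy').
move/first_darts_inj => /(_ y'r x'r) y'E.
by rewrite -eq_porbit_mem; move: xx' yy'; rewrite -!eq_porbit_mem y'E => /eqP-> /eqP->.
Qed.

Lemma card_theta_faces : #|porbits W| = 3.
Proof.
exact: (card_porbits_reps missed_path_walk uniq_first_darts first_darts_inj face_repr).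
Qed.

Lemma theta_connected : connected (@adj theta_graph).
Proof.
have adj_edge e : adj (theta_src e : theta_graph) (theta_tgt e).
  by apply/existsP; exists (e, true).
have sym := sym_connect_sym (@adj_sym theta_graph).
have from7 e : e < m.+2 -> connect (@adj theta_graph) (inord 7) (theta_tgt (inord e)).
  elim/ltn_ind: e => e IHe em.
  apply: connect_trans (connect1 (adj_edge _)).
  have [|not_first] := boolP (e \in [:: 0; 4; 8]).
    rewrite !inE => first; rewrite /theta_src inordK // /src_nat.
    by case/or3P: first => /eqP -> /=; exact: connect0.
  move: not_first; rewrite !inE !negb_or => /and3P[e0 e4 e8].
  have -> : theta_src (inord e) = theta_tgt (inord e.-1) :> 'I_m.+1.
    apply: val_inj; rewrite /= val_src val_tgt !inordK; try lia.
    by rewrite /src_nat /tgt_nat; split_ifs; lia.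
  by apply: IHe; lia.
have {}from7 (v : 'I_m.+1) : connect (@adj theta_graph) (inord 7) v.
  have [v7|v7] := eqVneq (v : nat) 7.
    have -> : v = inord 7 by apply: val_inj; rewrite /= inordK //; lia.
    exact: connect0.
  (* Every vertex other than 7 is the target of the edge bearing its number. *)
  have -> : v = theta_tgt (inord v).
    have := ltn_ord v => v_lt.
    by apply: val_inj; rewrite /= val_tgt inordK /tgt_nat; split_ifs; lia.
  by apply: from7; have := ltn_ord v; lia.
by move=> x y; apply: connect_trans (from7 y); rewrite sym.
Qed.

Lemma theta_euler : #|theta_graph| + #|porbits W| = #|edges theta_graph| + 2.
Proof. by rewrite card_theta_faces card_edges_list !card_ord; lia. Qed.

Definition theta_plane : plane_graph :=
  PlaneGraph (list_rotP (@theta_step_inj q) (@tl_step q) (@tl_rotation q))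
    theta_connected theta_euler.

(** The two darts of an edge are labelled by the two paths not containing it, so they lie on
    different faces. *)
Lemma theta_two_edge_connected : two_edge_connected theta_plane.
Proof.
apply: two_edge_connected_walk => [|d]; first by rewrite card_ord; lia.
rewrite porbit_missed_path -[d](undartK (simple := @theta_simple q)) rev_mkdart !mkdartK.
by case: (un d) => e b; rewrite /missed_path /=; case: b => /=; lia.
Qed.

End ThetaPlane.

(** * Color counts on faces and paths *)

Section ThetaColors.

Variable q : nat.

Local Notation m := (4 * q + 10).
Local Notation G := (theta_plane q).
Local Notation mk := (mkdart (@theta_simple q)).
Local Notation un := (undart (simple := @theta_simple q)).
Local Notation ed := (edge (@theta_simple q)).
Local Notation step := (@theta_step q).

Definition theta_edge (e : nat) : {set G} := ed (inord e).

Definition path_edges (i : nat) : seq nat :=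
  if i == 0 then iota 0 4 else if i == 1 then iota 4 4 else iota 8 (4 * q + 4).

Definition path_colors (c : {set G} -> nat) (i : nat) : seq nat :=
  [seq c (theta_edge e) | e <- path_edges i].

Lemma facesP (f : {set dart G}) :
  reflect (exists x, f = porbit (walk_next G) x) (f \in faces G).
Proof. by apply: (iffP imsetP) => [[x _ ->]|[x ->]]; exists x. Qed.

Lemma walk_theta d : walk_next G (mk d) = mk (step d).
Proof. exact: walk_permE. Qed.

Lemma missed_path_lt (d : 'I_m.+2 * bool) : missed_path d < 3.
Proof. by rewrite /missed_path ltn_mod. Qed.

Lemma face_edges_theta (x : dart G) :
  face_edges (porbit (walk_next G) x) =
  [set ed e | e : 'I_m.+2 & path_of e != missed_path (un x)].
Proof.
apply/setP => S; apply/imsetP/imsetP => [[y]|[e]].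
  rewrite porbit_missed_path -[y](undartK (simple := @theta_simple q)) mkdartK => xy ->.
  exists (un y).1; last by rewrite edge_of_mkdart.
  rewrite inE -(eqP xy) /missed_path /path_of.
  by case: (un y).2; repeat case: ltnP => ?.
rewrite inE => e_path ->.
(* The two directions of [e] realize the two labels other than [path_of e], so one of them
   matches. *)
suff [b yx] : exists b, missed_path (e, b) == missed_path (un x).
  by exists (mk (e, b)); rewrite ?edge_of_mkdart // porbit_missed_path mkdartK.
move: e_path (missed_path_lt (un x)); case: (missed_path (un x)) => [|[|[|]]] //;
  rewrite /missed_path /path_of /=; (repeat case: ltnP => ?) => // _ _;
  first [by exists true | by exists false].
Qed.

Lemma iota_paths : iota 0 m.+2 = path_edges 0 ++ path_edges 1 ++ path_edges 2.
Proof.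
have -> : m.+2 = 4 + (4 + (4 * q + 4)) by lia.
by rewrite iotaD [iota (0 + 4) _]iotaD.
Qed.

Lemma path_of_edges i e : i < 3 -> e \in path_edges i -> path_of e = i.
Proof.
by case: i => [|[|[|]]] // _; rewrite /path_edges /path_of mem_iota;
  repeat case: ltnP => ? //=; lia.
Qed.

Lemma face_color_count (c : {set G} -> nat) (x : dart G) (a : nat) :
  #|[set S in face_edges (porbit (walk_next G) x) | c S == a]| =
  \sum_(i <- [:: 0; 1; 2] | i != missed_path (un x)) count_mem a (path_colors c i).
Proof.
set j := missed_path _; pose P e := (path_of e != j) && (c (theta_edge e) == a).
have -> : [set S in face_edges (porbit (walk_next G) x) | c S == a] =
    ed @: [set e : 'I_m.+2 | P e].
  rewrite face_edges_theta; apply/setP => S; apply/setIdP/imsetP.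
    move=> [/imsetP[e e_path ->] cS]; exists e => //.
    by move: e_path; rewrite !inE /P /theta_edge inord_val => ->.
  move=> [e]; rewrite inE /P /theta_edge inord_val => /andP[e_path cS] ->.
  by split=> //; apply: imset_f; rewrite inE.
rewrite card_imset; last exact: edge_inj.
have -> : #|[set e : 'I_m.+2 | P e]| = count P (iota 0 m.+2).
  rewrite -sum1_card -[iota 0 m.+2]/(index_iota 0 m.+2) -sum1_count big_mkord.
  by apply: eq_bigl => e; rewrite inE.
have count_path i : i < 3 -> count P (path_edges i) =
    if i != j then count_mem a (path_colors c i) else 0.
  move=> i3; rewrite /path_colors count_map.
  have -> : count P (path_edges i) =
      count (fun e => (i != j) && (c (theta_edge e) == a)) (path_edges i).
    by apply: eq_in_count => e /(path_of_edges i3) e_path; rewrite /P e_path.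
  by case: (i != j) => //; rewrite (eq_count (a2 := pred0)) ?count_pred0.
rewrite iota_paths !count_cat !count_path // big_mkcond !big_cons big_nil.
by rewrite -[X in _ = X]/(_ + (_ + (_ + 0))) addn0.
Qed.

(** * The lower bound *)

Section LowerBound.

Variable c : {set G} -> nat.
Hypothesis c_parity : facial_parity c.

(** The three face counts add up to twice the total, so they are not all odd and one of them is
    zero. That removes the color from two paths, and a remaining face count is its multiplicity on
    the third. *)
Lemma color_one_path (a : nat) :
  let x i := count_mem a (path_colors c i) in
  [\/ [/\ x 0 = 0, x 1 = 0 & x 2 = 0], [/\ odd (x 0), x 1 = 0 & x 2 = 0],
      [/\ x 0 = 0, odd (x 1) & x 2 = 0] | [/\ x 0 = 0, x 1 = 0 & odd (x 2)]].
Proof.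
move=> x.
have face_parity e : let j := missed_path (inord e : 'I_m.+2, true) in
    let s := \sum_(i <- [:: 0; 1; 2] | i != j) x i in s = 0 \/ odd s.
  have [_ /(_ (porbit (walk_next G) (mk (inord e, true))) a)] := c_parity.
  by rewrite face_color_count mkdartK; apply; apply/facesP; eexists.
have:= face_parity 8; have := face_parity 4; have := face_parity 0.
rewrite /missed_path /= !inordK; try lia.
rewrite /= !big_cons !big_nil /= !addn0.
move: (x 0) (x 1) (x 2) => x0 x1 x2 h0 h1 h2.
have [x0z|x0z] := eqVneq x0 0; have [x1z|x1z] := eqVneq x1 0;
  have [x2z|x2z] := eqVneq x2 0; first [
  by apply: Or41; split; lia| by apply: Or42; split; lia |
  by apply: Or43; split; lia| by apply: Or44; split; lia | exfalso; lia].
Qed.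

Lemma path_colors_odd i a : i < 3 -> a \in path_colors c i ->
  odd (count_mem a (path_colors c i)).
Proof.
rewrite -has_pred1 has_count; have := color_one_path a.
by case: i => [|[|[|]]] //= + _; case=> -[]; lia.
Qed.

Lemma path_colors_disjoint i j a : i < 3 -> j < 3 ->
  a \in path_colors c i -> a \in path_colors c j -> i = j.
Proof.
rewrite -!has_pred1 !has_count; have := color_one_path a.
by case: i => [|[|[|]]] //=; case: j => [|[|[|]]] //= + _ _; case=> -[]; lia.
Qed.

Lemma path_colors_sorted i : i < 3 -> sorted (fun a b => a != b) (path_colors c i).
Proof.
move=> i3; have [proper _] := c_parity.
have neq e : e < m.+1 -> e != 3 -> e != 7 ->
    c (theta_edge e) != c (theta_edge e.+1).
  move=> em e3 e7; apply/eqP.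
  have := proper _ _ _ (porbit_id (walk_next G) (mk (inord e, true))).
  rewrite walk_theta !edge_of_mkdart /theta_edge /theta_step /walk_nat /=.
  rewrite inordK ?(negPf e3) ?(negPf e7); last by lia.
  by rewrite ltn_eqF // => /(_ ltac:(by apply/facesP; eexists)).
rewrite /path_colors sorted_map.
(* The side conditions keep the interval from crossing from edge 3 to 4 or from 7 to 8, where one
   path ends and the next begins. *)
have mono b l : b + l <= m.+2 -> (3 < b) || (b + l <= 4) -> (7 < b) || (b + l <= 8) ->
    sorted (fun e f => c (theta_edge e) != c (theta_edge f)) (iota b l).
  case: l => //= l; elim: l b => //= l IHl b bl b3 b7.
  by rewrite neq ?IHl //; lia.
case: i i3 => [|[|[|]]] // _; apply: mono; lia.
Qed.

Lemma size_path_colors i : i < 3 ->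
  size (path_colors c i) = if i < 2 then 4 else 4 * q.+1.
Proof. by case: i => [|[|[|]]] // _; rewrite size_map //= size_iota; lia. Qed.

Lemma four_path_colors i : i < 3 -> 4 <= size (undup (path_colors c i)).
Proof.
move=> i3; apply: four_colors_path; rewrite ?size_path_colors //.
- by case: ifP.
- by case: ifP => // _; rewrite dvdn_mulr.
- exact: path_colors_sorted.
- by move=> a; apply: path_colors_odd.
Qed.

Lemma theta_lower_bound : 12 <= num_colors c.
Proof.
pose u i := undup (path_colors c i).
have -> : 12 = 4 + (4 + 4) by [].
apply: (@leq_trans (size (u 0 ++ u 1 ++ u 2))).
  by rewrite !size_cat !leq_add // four_path_colors.
apply: uniq_leq_size.
  rewrite !cat_uniq !undup_uniq has_cat /= andbT -!negb_or; apply/norP; split.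
    apply/norP; split; apply/hasPn => a; rewrite /u !mem_undup => ai;
      apply/negP => /= aj; by have := path_colors_disjoint _ _ ai aj; move=> /(_ isT isT).
  apply/hasPn => a; rewrite /u !mem_undup => ai; apply/negP => /= aj.
  by have := path_colors_disjoint _ _ ai aj; move=> /(_ isT isT).
move=> a; rewrite !mem_cat /u !mem_undup => /or3P[] /mapP[e _ ->]; apply: map_f;
  by rewrite mem_enum edges_list imset_f.
Qed.

End LowerBound.

(** * A coloring with twelve colors *)

(** The first twelve edges get their own colors; the rest of the third path alternates 8 and 9,
    adding the even number [2 * q] of occurrences to each. *)
Definition theta_color (e : nat) : nat := if e < 12 then e else 8 + odd e.

(** The value 0 is a default for sets that are not edges. *)
Definition theta_coloring (S : {set G}) : nat :=
  if [pick e | ed e == S] is Some e then theta_color e else 0.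

Lemma theta_coloringE (e : 'I_m.+2) : theta_coloring (ed e) = theta_color e.
Proof.
rewrite /theta_coloring; case: pickP => [f /eqP/edge_inj -> //|/(_ e)].
by rewrite eqxx.
Qed.

Lemma path_colors_theta i :
  path_colors theta_coloring i = [seq theta_color e | e <- path_edges i].
Proof.
apply/eq_in_map => e e_path; rewrite /theta_edge theta_coloringE inordK //.
by move: e_path; rewrite /path_edges; do 2?case: ifP => _; rewrite mem_iota; lia.
Qed.

Lemma count_theta_color_tail a :
  count_mem a [seq theta_color e | e <- iota 12 (4 * q)] = ((8 == a) + (9 == a)) * (2 * q).
Proof.
elim: q => [|n IHn]; first by rewrite !muln0.
have -> : 4 * n.+1 = 4 * n + 4 by lia.
rewrite iotaD map_cat count_cat IHn.
have -> : [seq theta_color e | e <- iota (12 + 4 * n) 4] = [:: 8; 9; 8; 9].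
  by rewrite /= /theta_color; do 4![case: ltnP => ?; first by lia]; congr [:: _; _; _; _]; lia.
by rewrite /=; lia.
Qed.

Lemma theta_coloring_parity : facial_parity theta_coloring.
Proof.
split=> [_ /facesP[x ->] d _|_ a /facesP[x ->]].
  rewrite -[d](undartK (simple := @theta_simple q)) walk_theta !edge_of_mkdart.
  rewrite !theta_coloringE val_step; case: (un d) => e b /=.
  have := ltn_ord e; rewrite /walk_nat /theta_color.
  by case: b; split_ifs; repeat case: ltnP => ? /=; lia.
have path2 : [seq theta_color e | e <- path_edges 2] =
    [:: 8; 9; 10; 11] ++ [seq theta_color e | e <- iota 12 (4 * q)].
  by rewrite /path_edges addnC iotaD.
rewrite face_color_count (eq_bigr _ (fun i _ => congr1 _ (path_colors_theta i))).
rewrite !big_cons big_nil path2 count_cat count_theta_color_tail.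
rewrite -[map _ (path_edges 0)]/(iota 0 4) -[map _ (path_edges 1)]/(iota 4 4).
(* Colors 0 to 11 are checked one by one on each face; larger numbers do not occur. *)
case: (missed_path _) (missed_path_lt (un x)) => [|[|[|]]] // _ /=;
  by do 12?[case: a => [|a]; first by rewrite /=; lia]; lia.
Qed.

Lemma num_colors_theta : num_colors theta_coloring = 12.
Proof.
rewrite /num_colors -[RHS](size_iota 0); apply/perm_size/uniq_perm.
- exact: undup_uniq.
- exact: iota_uniq.
move=> a; rewrite mem_undup mem_iota /= add0n; apply/mapP/idP => [[S]|a12].
  rewrite mem_enum edges_list => /imsetP[e _ ->] ->.
  by rewrite theta_coloringE /theta_color; case: (ltnP e 12); lia.
have a_lt : a < m.+2 by have : a < 12 := a12; lia.
exists (theta_edge a); first by rewrite mem_enum edges_list imset_f.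
by rewrite theta_coloringE inordK // /theta_color a12.
Qed.

End ThetaColors.

Theorem theorem1 (k : nat) (hk : 3 <= k) :
  exists G : plane_graph,
    [/\ two_edge_connected G, #|edges G| = 4 * k & is_facial_parity_index G 12].
Proof.
(* The subtraction is exact by [hk], giving [4 * (k - 3) + 12 = 4 * k] edges. *)
exists (theta_plane (k - 3)); split.
- exact: theta_two_edge_connected.
- by rewrite card_edges_list card_ord; lia.
- split=> [|c]; last exact: theta_lower_bound.
  by exists (@theta_coloring (k - 3)); [exact: theta_coloring_parity|exact: num_colors_theta].
Qed.
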